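(* Let $\boldsymbol\xi_1,\dots,\boldsymbol\xi_N\in\mathbb R^d$, $d_{ij}=\|\boldsymbol\xi_i-\boldsymbol\xi_j\|^2$, let $K\ge1$ and $n_0\ge0$ be integers with $n=(N-n_0)/K\in\mathbb N$, and let $n_k=n$ for $k=1,\dots,K$. Assume there exists a partition $(J_0,J_1,\dots,J_K)$ of $\{1,\dots,N\}$ with $|J_k|=(N-n_0)/K$ for $k=1,\dots,K$ (so $|J_0|=n_0$) such that $$\max_{1\le k\le K}\max_{i,j\in J_k}d_{ij}<\min_{1\le k_1<k_2\le K}\ \min_{i\in J_{k_1},\,j\in J_{k_2}}d_{ij}\quad\text{and}\quad\max_{1\le k\le K}\max_{i,j\in J_k}d_{ij}<\min_{i\in J_0,\ j\in\{1,\dots,N\}\setminus\{i\}}d_{ij}.$$ Then the optimal values of $\mathcal R^{\mathrm{ob}}_{\mathrm{LP}}$ and $\mathcal P^{\mathrm o}$ (defined in the context) coincide. Moreover, the clustering $(J_0,\dots,J_K)$ is optimal in $\mathcal P^{\mathrm o}$, and it is recovered (up to relabeling of the clusters $1,\dots,K$) by the rounding algorithm for joint outlier detection and balanced clustering described in the context.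
   Context: $\|\cdot\|$ is the Euclidean norm, $\langle\mathbf A,\mathbf B\rangle=\mathrm{Tr}(\mathbf A\mathbf B)$, $\mathbf 1$ is the all-ones vector, $\mathrm{diag}(\mathbf A)$ the vector of diagonal entries; $\succeq$ is the positive semidefinite order and $\ge,\le$ between matrices are elementwise. $\mathbb S^N$ is the set of symmetric $N\times N$ matrices and $\mathbf D=(d_{ij})\in\mathbb S^N$. A minimum over the empty set is $+\infty$. Problem $\mathcal P^{\mathrm o}$ (joint outlier detection and cardinality-constrained clustering, with outlier cluster $k=0$): minimize $\frac12\sum_{k=1}^K\frac1{n_k}\sum_{i,j=1}^N d_{ij}\eta_{ij}^k$ over $\pi_i^k\in\{0,1\}$, $\eta_{ij}^k\in\mathbb R_+$ ($i,j=1,\dots,N$, $k=0,\dots,K$) subject to $\sum_{i=1}^N\pi_i^k=n_k$ for $k=0,\dots,K$, $\sum_{k=0}^K\pi_i^k=1$ for all $i$, and $\eta_{ij}^k\ge\pi_i^k+\pi_j^k-1$ for all $i,j$ and $k=0,\dots,K$. A clustering $(I_0,\dots,I_K)$ corresponds to $\pi_i^k=1$ if $i\in I_k$, $\pi_i^k=0$ otherwise, and $\eta_{ij}^k=\max\{\pi_i^k+\pi_j^k-1,0\}$. For an integer $m\ge0$, $\mathcal C_{\mathrm{SDP}}(m)$ is the set of all $(\boldsymbol x,\mathbf M)\in\mathbb R^N\times\mathbb S^N$ such that (i) $\mathbf 1^\top\boldsymbol x=2m-N$, $\mathbf M\mathbf 1=(2m-N)\boldsymbol x$, $\mathrm{diag}(\mathbf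 M)=\mathbf 1$; (ii) $\mathbf M\succeq\boldsymbol x\boldsymbol x^\top$; (iii) $\mathbf M+\mathbf 1\mathbf 1^\top+\boldsymbol x\mathbf 1^\top+\mathbf 1\boldsymbol x^\top\ge\mathbf 0$, $\mathbf M+\mathbf 1\mathbf 1^\top-\boldsymbol x\mathbf 1^\top-\mathbf 1\boldsymbol x^\top\ge\mathbf 0$, $\mathbf M-\mathbf 1\mathbf 1^\top+\boldsymbol x\mathbf 1^\top-\mathbf 1\boldsymbol x^\top\le\mathbf 0$, $\mathbf M-\mathbf 1\mathbf 1^\top-\boldsymbol x\mathbf 1^\top+\mathbf 1\boldsymbol x^\top\le\mathbf 0$. $\mathcal C_{\mathrm{LP}}(m)$ is defined by (i) and (iii) only. Problem $\mathcal R^{\mathrm{ob}}_{\mathrm{SDP}}$: minimize $\frac K{8n}\langle\mathbf D,\mathbf M+\mathbf 1\mathbf 1^\top+\boldsymbol x\mathbf 1^\top+\mathbf 1\boldsymbol x^\top\rangle$ subject to $(\boldsymbol x,\mathbf M)\in\mathcal C_{\mathrm{SDP}}(n)$, $(\boldsymbol x^0,\mathbf M^0)\in\mathcal C_{\mathrm{SDP}}(n_0)$, $K\boldsymbol x+\boldsymbol x^0=(1-K)\mathbf 1$. Problem $\mathcal R^{\mathrm{ob}}_{\mathrm{LP}}$ is obtained by replacing $\mathcal C_{\mathrm{SDP}}$ with $\mathcal C_{\mathrm{LP}}$ in both places. Problem $\mathcal R^{\mathrm b}_{\mathrm{SDP}}$ (for $N$ datapoints and $K=N/n$ clusters, no outliers):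 minimize $$\tfrac1{8n}\big\langle\mathbf D,\ \mathbf M^1+\mathbf 1\mathbf 1^\top+\boldsymbol x^1\mathbf 1^\top+\mathbf 1(\boldsymbol x^1)^\top+(K-1)(\mathbf M+\mathbf 1\mathbf 1^\top+\boldsymbol x\mathbf 1^\top+\mathbf 1\boldsymbol x^\top)\big\rangle$$ subject to $(\boldsymbol x^1,\mathbf M^1),(\boldsymbol x,\mathbf M)\in\mathcal C_{\mathrm{SDP}}(n)$, $\boldsymbol x^1+(K-1)\boldsymbol x=(2-K)\mathbf 1$, $x^1_1=1$. $\mathcal R^{\mathrm b}_{\mathrm{LP}}$ is obtained by replacing $\mathcal C_{\mathrm{SDP}}(n)$ with $\mathcal C_{\mathrm{LP}}(n)$. Rounding algorithm for balanced clustering (subroutine). Input: an index set $\mathcal I_1$ and cluster size $n$ with $|\mathcal I_1|=Kn$. For $k=1,\dots,K-1$: (a) solve $\mathcal R^{\mathrm b}_{\mathrm{SDP}}$ or $\mathcal R^{\mathrm b}_{\mathrm{LP}}$ for the datapoints $\boldsymbol\xi_i$, $i\in\mathcal I_k$ (i.e. with $N$ replaced by $|\mathcal I_k|$, $K$ by $|\mathcal I_k|/n$, $\mathbf D$ restricted to $\mathcal I_k$, and $x_1^1=1$ imposed on the first datapoint of $\mathcal I_k$), and record the $\boldsymbol x^1$ of an (arbitrary) optimal solution, with entries indexed by $\mathcal I_k$; (b) determine a bijection $\rho:\{1,\dots,|\mathcal I_k|\}\to\mathcal I_k$ with $x^1_{\rho(1)}\ge\dots\ge x^1_{\rho(|\mathcal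 I_k|)}$; (c) set $I_k=\{\rho(1),\dots,\rho(n)\}$, $\mathcal I_{k+1}=\mathcal I_k\setminus I_k$. Finally set $I_K=\mathcal I_K$ and output $I_1,\dots,I_K$. Rounding algorithm for joint outlier detection and balanced clustering. Input: $\mathcal I_0=\{1,\dots,N\}$, sizes $n_0$ and $n_1=\dots=n_K=n$. (1) Solve $\mathcal R^{\mathrm{ob}}_{\mathrm{SDP}}$ or $\mathcal R^{\mathrm{ob}}_{\mathrm{LP}}$ for the datapoints $\boldsymbol\xi_i$, $i\in\mathcal I_0$, and record the $\boldsymbol x^0\in\mathbb R^N$ of an (arbitrary) optimal solution. (2) Determine a bijection $\rho:\mathcal I_0\to\mathcal I_0$ with $x^0_{\rho(1)}\ge\dots\ge x^0_{\rho(N)}$. (3) Set $I_0=\{\rho(1),\dots,\rho(n_0)\}$ and $\mathcal I_1=\mathcal I_0\setminus I_0$. (4) Call the subroutine with input $(\mathcal I_1,n)$ to obtain $I_1,\dots,I_K$. Output: $I_0,\dots,I_K$.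
   Formalization: That every run of the rounding algorithm (any optimal solution, any tie-breaking) recovers the clustering is claimed only if n_0 = 0 or n > 1; for n = 1, n_0 ≥ 1 all clusterings cost 0, so other outlier sets may be returned, and only existence of a recovering run is claimed. *)

(* Defs.v *)
From HB Require Import structures.
From mathcomp Require Import all_boot all_order all_algebra perm.
From mathcomp Require Import all_classical all_reals ereal.

Set Implicit Arguments.
Unset Strict Implicit.
Unset Printing Implicit Defensive.

Import Order.TTheory GRing.Theory Num.Theory.
Local Open Scope ring_scope.

(* The library norm on matrices is the sup norm, hence an explicit Euclidean
   norm. *)
Definition euclidean_norm (R : realType) (d : nat) (v : 'rV[R]_d) : R :=
  Num.sqrt (\sum_(i < d) v 0 i ^+ 2).

Definition sq_dist_mx (R : realType) (N d : nat) (xi : 'I_N -> 'rV[R]_d) :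
    'M[R]_N :=
  \matrix_(i, j) euclidean_norm (xi i - xi j) ^+ 2.

Definition ones (R : realType) (N : nat) : 'cV[R]_N := const_mx 1.
Arguments ones {R N}.

Definition mx_le (R : realType) (m n : nat) (A B : 'M[R]_(m, n)) : Prop :=
  forall i j, A i j <= B i j.

Definition psd (R : realType) (N : nat) (A : 'M[R]_N) : Prop :=
  A^T = A /\ forall v : 'cV[R]_N, 0 <= (v^T *m A *m v) 0 0.

Definition mx_inner (R : realType) (N : nat) (A B : 'M[R]_N) : R :=
  \tr (A *m B).

Definition is_minimizer (R : realType) (T : Type) (feas : set T)
    (obj : T -> R) (z : T) : Prop :=
  feas z /\ forall z', feas z' -> obj z <= obj z'.

Definition optimal_value (R : realType) (T : Type) (feas : set T)
    (obj : T -> R) : \bar R :=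
  ereal_inf [set (obj z)%:E | z in feas]%classic.

(* A clustering is a family indexed by 'I_K.+1; index ord0 is the outlier
   cluster. *)
Definition is_clustering (N K : nat) (J : 'I_K.+1 -> {set 'I_N}) : Prop :=
  (forall k l, k != l -> [disjoint J k & J l]) /\
  \bigcup_(k < K.+1) J k = [set: 'I_N]%SET.

(* Maxima and minima are taken in the extended reals, so that a minimum over
   an empty set is +oo. *)
Definition max_within (R : realType) (N K : nat) (D : 'M[R]_N)
    (J : 'I_K.+1 -> {set 'I_N}) : \bar R :=
  \big[maxe/-oo%E]_(k < K.+1 | k != ord0)
    \big[maxe/-oo%E]_(i in J k) \big[maxe/-oo%E]_(j in J k) (D i j)%:E.

Definition min_between (R : realType) (N K : nat) (D : 'M[R]_N)
    (J : 'I_K.+1 -> {set 'I_N}) : \bar R :=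
  \big[mine/+oo%E]_(k1 < K.+1 | k1 != ord0)
    \big[mine/+oo%E]_(k2 < K.+1 | (k1 < k2)%N)
      \big[mine/+oo%E]_(i in J k1) \big[mine/+oo%E]_(j in J k2) (D i j)%:E.

Definition min_outlier (R : realType) (N K : nat) (D : 'M[R]_N)
    (J : 'I_K.+1 -> {set 'I_N}) : \bar R :=
  \big[mine/+oo%E]_(i in J ord0) \big[mine/+oo%E]_(j | j != i) (D i j)%:E.

Definition cluster_sizes (K n0 n : nat) (k : 'I_K.+1) : nat :=
  if k == ord0 then n0 else n.

(* Decision variables (pi, eta) of the assignment problem. *)
Definition Po_var (R : realType) (N K : nat) : Type :=
  ('M[R]_(N, K.+1) * ('I_K.+1 -> 'M[R]_N))%type.

Definition Po_feasible (R : realType) (N K : nat) (nk : 'I_K.+1 -> nat) :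
    set (Po_var R N K) := fun z =>
  let: (p, eta) := z in
  (forall i k, p i k = 0 \/ p i k = 1) /\
  (forall k i j, 0 <= eta k i j) /\
  (forall k, \sum_(i < N) p i k = (nk k)%:R) /\
  (forall i, \sum_(k < K.+1) p i k = 1) /\
  (forall k i j, p i k + p j k - 1 <= eta k i j).

Definition Po_obj (R : realType) (N K : nat) (D : 'M[R]_N)
    (nk : 'I_K.+1 -> nat) (z : Po_var R N K) : R :=
  2^-1 * \sum_(k < K.+1 | k != ord0)
    (nk k)%:R^-1 * \sum_(i < N) \sum_(j < N) D i j * z.2 k i j.

Definition Po_of_clustering (R : realType) (N K : nat)
    (J : 'I_K.+1 -> {set 'I_N}) : Po_var R N K :=
  let p : 'M[R]_(N, K.+1) := \matrix_(i, k) (i \in J k)%:R in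
  (p, fun k => \matrix_(i, j) Num.max (p i k + p j k - 1) 0).

Inductive relaxation := SDP | LP.

Definition rel_var (R : realType) (N : nat) : Type :=
  ('cV[R]_N * 'M[R]_N)%type.

Definition C_rel (R : realType) (r : relaxation) (N m : nat) :
    set (rel_var R N) := fun z =>
  let: (x, M) := z in
  M^T = M /\
  [/\ ones^T *m x = (2 * m%:R - N%:R)%:M,
      M *m ones = (2 * m%:R - N%:R) *: x &
      forall i, M i i = 1] /\
  (if r is SDP then psd (M - x *m x^T) else True) /\
  [/\ mx_le 0 (M + ones *m ones^T + x *m ones^T + ones *m x^T),
      mx_le 0 (M + ones *m ones^T - x *m ones^T - ones *m x^T),
      mx_le (M - ones *m ones^T + x *m ones^T - ones *m x^T) 0 &
      mx_le (M - ones *m ones^T - x *m ones^T + ones *m x^T) 0].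

Definition lift_mx (R : realType) (N : nat) (z : rel_var R N) : 'M[R]_N :=
  z.2 + ones *m ones^T + z.1 *m ones^T + ones *m z.1^T.

(* A point is ((x, M), (x^0, M^0)). *)
Definition Rob_feasible (R : realType) (r : relaxation) (N K n0 n : nat) :
    set (rel_var R N * rel_var R N) := fun z =>
  [/\ C_rel r n z.1, C_rel r n0 z.2 &
      K%:R *: z.1.1 + z.2.1 = (1 - K%:R) *: ones].

Definition Rob_obj (R : realType) (N K n : nat) (D : 'M[R]_N)
    (z : rel_var R N * rel_var R N) : R :=
  K%:R / (8 * n%:R) * mx_inner D (lift_mx z.1).

(* A point is ((x^1, M^1), (x, M)); the last condition is x^1_1 = 1. *)
Definition Rb_feasible (R : realType) (r : relaxation) (N K n : nat) :
    set (rel_var R N * rel_var R N) := fun z =>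
  [/\ C_rel r n z.1, C_rel r n z.2,
      z.1.1 + (K%:R - 1) *: z.2.1 = (2 - K%:R) *: ones &
      forall i : 'I_N, i = 0%N :> nat -> z.1.1 i 0 = 1].

Definition Rb_obj (R : realType) (N K n : nat) (D : 'M[R]_N)
    (z : rel_var R N * rel_var R N) : R :=
  (8 * n%:R)^-1 * mx_inner D (lift_mx z.1 + (K%:R - 1) *: lift_mx z.2).

Definition sorts_decreasingly (R : realType) (N : nat) (x : 'cV[R]_N)
    (rho : 'S_N) : Prop :=
  forall a b : 'I_N, (a <= b)%N -> x (rho b) 0 <= x (rho a) 0.

(* Restriction to the datapoints of S, listed in increasing order of index. *)
Definition restrict_mx (R : realType) (N : nat) (D : 'M[R]_N)
    (S : {set 'I_N}) : 'M[R]_#|S| :=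
  \matrix_(a, b) D (enum_val a) (enum_val b).

(* I is a possible result of extracting one cluster of size n from S; the
   bijection onto S is the composition of enum_val with a permutation of
   positions. *)
Definition extracts_cluster (R : realType) (N : nat) (D : 'M[R]_N)
    (r : relaxation) (n : nat) (S I : {set 'I_N}) : Prop :=
  exists (z : rel_var R #|S| * rel_var R #|S|) (rho : 'S_#|S|),
    [/\ is_minimizer (Rb_feasible r (#|S| %/ n) n)
          (Rb_obj (#|S| %/ n) n (restrict_mx D S)) z,
        sorts_decreasingly z.1.1 rho &
        I = [set enum_val (rho a) | a : 'I_#|S| & (a < n)%N]%SET].

(* The two rounding algorithms are given by the relations between their input
   and their possible outputs, as neither the optimal solutions nor the
   sorting bijections are unique.  The relaxation used in the k-th call is
   r k.  Here cI k is the set of datapoints remaining before cluster k is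
   extracted. *)
Definition balanced_rounding (R : realType) (N K : nat) (D : 'M[R]_N)
    (r : nat -> relaxation) (n : nat) (S : {set 'I_N})
    (I : 'I_K.+1 -> {set 'I_N}) : Prop :=
  exists cI : nat -> {set 'I_N},
    [/\ cI 1%N = S,
        forall k : 'I_K.+1, (0 < k < K)%N ->
          extracts_cluster D (r k) n (cI k) (I k) /\
          cI k.+1 = cI k :\: I k &
        I ord_max = cI K].

Definition joint_rounding (R : realType) (N K : nat) (D : 'M[R]_N)
    (r : nat -> relaxation) (n0 n : nat) (I : 'I_K.+1 -> {set 'I_N}) : Prop :=
  exists (z : rel_var R N * rel_var R N) (rho : 'S_N),
    [/\ is_minimizer (Rob_feasible (r 0%N) K n0 n) (Rob_obj K n D) z,
        sorts_decreasingly z.2.1 rho,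
        I ord0 = [set rho a | a : 'I_N & (a < n0)%N]%SET &
        balanced_rounding D r n ([set: 'I_N]%SET :\: I ord0) I].

Definition equal_up_to_relabeling (N K : nat)
    (I J : 'I_K.+1 -> {set 'I_N}) : Prop :=
  exists s : 'S_K.+1, s ord0 = ord0 /\ forall k, I k = J (s k).

(* Main.v *)
(* In the variables y = (1 + x) / 2 and W_ij = (M_ij + 1 + x_i + x_j) / 4, the
   constraints of C_LP(m) read: y sums to m, each row i of W sums to m y_i,
   W_ii = y_i, and max(0, y_i + y_j - 1) <= W_ij <= min(y_i, y_j).  Hence the
   combined weights V (that is K W for R^ob, W^1 + (K - 1) W for R^b, and the sum
   over k >= 1 of pi_i^k pi_j^k for P^o) lie in [0, 1] and have total weight
   K n (n - 1) off the diagonal.  By separation, the K n (n - 1) smallest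
   off-diagonal distances are those within the clusters, so the cost is smallest
   exactly when V is the same-cluster indicator off the diagonal.  This determines
   x^0 when n > 1, and x^1 always, because x^1_1 = 1 forces row 1 of W^1 to
   fill up the cluster of point 1.  The minimum is attained at averages of cluster
   indicators, which also satisfy the semidefinite constraint. *)
Require Import Defs.
From HB Require Import structures.
From mathcomp Require Import all_boot all_order all_algebra perm.
From mathcomp Require Import all_classical all_reals ereal.
From mathcomp Require Import ring lra zify.

Import Order.TTheory GRing.Theory Num.Theory.
Local Open Scope ring_scope.

(** * Cost comparison under separated distances *)

(* [c] labels the points; the labels outside [L] mark outliers. *)
Definition same_cluster {N : nat} {T : finType} (c : 'I_N -> T) (L : {set T}) :
  rel 'I_N := fun i j => (c i == c j) && (c i \in L).

Definition total_cost {R : realType} {N : nat} (D : 'M[R]_N)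
    (V : 'I_N -> 'I_N -> R) : R :=
  \sum_i \sum_j D i j * V i j.

Definition well_separated {R : realType} {N : nat} (D : 'M[R]_N) (E : rel 'I_N)
    (beta : R) : Prop :=
  [/\ forall i, D i i = 0,
      forall i j, E i j -> D i j <= beta &
      forall i j, i != j -> ~~ E i j -> beta < D i j].

(* Both parts compare [V] with the indicator of [E] through
   [(D i j - beta) * (V i j - E i j)], which is nonnegative off the diagonal. *)
Lemma total_cost_ge {R : realType} {N : nat} {D : 'M[R]_N} {E : rel 'I_N}
    {beta : R} {V : 'I_N -> 'I_N -> R} :
  well_separated D E beta ->
  (forall i j, 0 <= V i j <= 1) ->
  \sum_i \sum_j V i j = \sum_i \sum_j (E i j)%:R ->
  \sum_i V i i = \sum_i (E i i)%:R ->
  total_cost D (fun i j => (E i j)%:R) <= total_cost D V /\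
  (total_cost D V <= total_cost D (fun i j => (E i j)%:R) ->
   forall i j, i != j -> V i j = (E i j)%:R).
Proof.
move=> [D0 Dle Dgt] V01 sumV trV.
(* Zeroing the diagonal turns sums over all pairs into sums over off-diagonal pairs. *)
pose off (f : 'I_N -> 'I_N -> R) i j := if i == j then 0 else f i j.
have sum_off f : \sum_i \sum_j off f i j
    = \sum_i \sum_j f i j - \sum_i f i i.
  rewrite -sumrB; apply: eq_bigr => i _.
  rewrite (bigD1 i) //= [in RHS](bigD1 i) //= /off eqxx add0r [X in X - _]addrC addrK.
  by apply: eq_bigr => j ji; rewrite eq_sym (negbTE ji).
have off_eq0 f : (forall i j, 0 <= off f i j) ->
    \sum_i \sum_j off f i j = 0 -> forall i j, i != j -> f i j = 0.
  move=> f0 /eqP; rewrite psumr_eq0 => [/allP sf i j ij|i _]; last first.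
    by apply: sumr_ge0.
  have := sf i (mem_index_enum _); rewrite psumr_eq0 // => /allP/(_ j).
  by rewrite mem_index_enum => /(_ isT) /=; rewrite /off (negbTE ij) => /eqP.
have sum_sub (f g : 'I_N -> 'I_N -> R) :
    \sum_i \sum_j (f i j - g i j) = \sum_i \sum_j f i j - \sum_i \sum_j g i j.
  by rewrite -sumrB; apply: eq_bigr => i _; rewrite sumrB.
pose G i j := V i j - (E i j)%:R.
have offG : \sum_i \sum_j off G i j = 0.
  by rewrite sum_off sum_sub sumrB sumV trV !subrr.
pose F i j := (D i j - beta) * G i j.
have F0 i j : 0 <= off F i j.
  rewrite /off; case: eqP => // /eqP ij; rewrite /F /G.
  have /andP[V0 V1] := V01 i j; case: (boolP (E i j)) => Eij.
    by rewrite mulr_le0 // subr_le0 ?Dle.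
  by rewrite subr0 mulr_ge0 // subr_ge0 ltW // Dgt.
have offF : \sum_i \sum_j off F i j
    = total_cost D V - total_cost D (fun i j => (E i j)%:R).
  (* The off-diagonal total of [G] is 0, so shifting the distances by [beta] leaves the sum
     unchanged. *)
  have -> : \sum_i \sum_j off F i j
      = \sum_i \sum_j off (fun i j => D i j * G i j) i j
        - beta * \sum_i \sum_j off G i j.
    rewrite mulr_sumr -sumrB; apply: eq_bigr => i _.
    rewrite mulr_sumr -sumrB; apply: eq_bigr => j _.
    by rewrite /off /F; case: eqP; rewrite ?mulr0 ?subr0 // mulrBl.
  rewrite offG mulr0 subr0 sum_off [X in _ - X]big1 ?subr0; last first.
    by move=> i _; rewrite D0 mul0r.
  rewrite -sum_sub; apply: eq_bigr => i _; apply: eq_bigr => j _.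
  by rewrite mulrBr.
split; first by rewrite -subr_ge0 -offF; do 2!apply: sumr_ge0 => ? _.
move=> leVE i j ij.
have FV0 : forall i j, i != j -> F i j = 0.
  apply: off_eq0 => //; apply/eqP; rewrite eq_le offF subr_le0 leVE /=.
  by rewrite -offF; do 2!apply: sumr_ge0 => ? _.
apply/esym/eqP; rewrite -subr_eq0; apply/eqP; move: i j ij.
(* Outside [E] the factor [D i j - beta] is positive, so V vanishes there. Inside [E] that factor
   may be 0; there V = 1 follows because E - V is nonnegative off the diagonal with total 0. *)
apply: (off_eq0 (fun i j => (E i j)%:R - V i j)) => [i j|]; last first.
  transitivity (- \sum_i \sum_j off G i j); last by rewrite offG oppr0.
  rewrite -sumrN; apply: eq_bigr => i _; rewrite -sumrN.
  by apply: eq_bigr => j _; rewrite /off /G; case: eqP; rewrite ?oppr0 ?opprB.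
rewrite /off; case: eqP => // /eqP ij.
case: (boolP (E i j)) => Eij; first by rewrite subr_ge0; case/andP: (V01 i j).
have /eqP := FV0 _ _ ij; rewrite /F /G (negbTE Eij) subr0 mulf_eq0.
by rewrite subr_eq0 gt_eqF ?Dgt //= => /eqP ->; rewrite subrr.
Qed.

(** * Change of variables from x and M to weights y and W *)

(** This is y, and [pair_prob] is W: for a single cluster they are its indicator and the pairwise
    products of the indicator. *)
Definition prob {R : realType} {N : nat} (z : rel_var R N) (i : 'I_N) : R :=
  (1 + z.1 i 0) / 2.

Definition pair_prob {R : realType} {N : nat} (z : rel_var R N)
    (i j : 'I_N) : R :=
  lift_mx z i j / 4.

Lemma lift_mxE {R : realType} {N : nat} (z : rel_var R N) i j :
  lift_mx z i j = z.2 i j + 1 + z.1 i 0 + z.1 j 0.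
Proof. by rewrite /lift_mx !mxE !big_ord1 !mxE; ring. Qed.

(** Summing M_ij + 1 + x_i + x_j over j gives (2m - N) x_i + N + N x_i + (2m - N) = 2m (1 + x_i),
    hence the row totals; the column totals follow by symmetry of M. *)
Lemma C_relP {R : realType} {r : relaxation} {N m : nat} {z : rel_var R N} :
  C_rel r m z ->
  [/\ \sum_i prob z i = m%:R,
      forall i, \sum_j pair_prob z i j = m%:R * prob z i,
      forall j, \sum_i pair_prob z i j = m%:R * prob z j,
      forall i, pair_prob z i i = prob z i &
      forall i j, [/\ 0 <= pair_prob z i j, pair_prob z i j <= prob z i &
                      pair_prob z i j <= prob z j]].
Proof.
case: z => x M [Msym] [[sx sM dM] [_ [ge0 _ le1 le2]]].
have sumx : \sum_i x i 0 = 2 * m%:R - N%:R.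
  have := congr1 (fun A : 'M_1 => A 0 0) sx; rewrite !mxE eqxx mulr1n => <-.
  by apply: eq_bigr => i _; rewrite !mxE mul1r.
have sumM i : \sum_j M i j = (2 * m%:R - N%:R) * x i 0.
  have := congr1 (fun A : 'cV_N => A i 0) sM; rewrite !mxE => <-.
  by apply: eq_bigr => j _; rewrite !mxE mulr1.
have pairC i j : pair_prob (x, M) i j = pair_prob (x, M) j i.
  rewrite /pair_prob !lift_mxE /=.
  by have := congr1 (fun A : 'M_N => A i j) Msym; rewrite mxE => ->; ring.
have row i : \sum_j pair_prob (x, M) i j = m%:R * prob (x, M) i.
  rewrite -mulr_suml; under eq_bigr do rewrite lift_mxE /=.
  rewrite !big_split /= !sumr_const card_ord sumx sumM.
  by rewrite -[x i 0 *+ N]mulr_natr /prob /=; field.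
split=> // [|j|i|i j].
- rewrite -mulr_suml big_split /= sumx sumr_const card_ord.
  by rewrite addrC subrK mulrAC divff ?mul1r.
- by under eq_bigr do rewrite pairC.
- by rewrite /pair_prob lift_mxE /= dM /prob /=; field.
- have := ge0 i j; have := le1 i j; have := le2 i j.
  rewrite /pair_prob /prob lift_mxE !mxE !big_ord1 !mxE /= => *.
  by split; lra.
Qed.

(** * Averages of cluster indicators *)

(* The average over l in [L] of the points given by the cluster indicators: y is
   the mean of the indicators u_l and W is the mean of the u_l u_l^T. *)
Definition average_point {R : realType} {N : nat} {T : finType}
    (c : 'I_N -> T) (L : {set T}) : rel_var R N :=
  let y i := #|L|%:R^-1 * (c i \in L)%:R in
  (\col_i (2 * y i - 1),
   \matrix_(i, j)
     (4 * (#|L|%:R^-1 * (same_cluster c L i j)%:R) + 1 - 2 * y i - 2 * y j)).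

Lemma pair_prob_average {R : realType} {N : nat} {T : finType} (c : 'I_N -> T)
    (L : {set T}) i j :
  pair_prob (average_point c L) i j
  = #|L|%:R^-1 * (same_cluster c L i j)%:R :> R.
Proof.
rewrite /pair_prob lift_mxE !mxE; set a := _ * (same_cluster _ _ _ _)%:R.
by set b := _ * (c i \in L)%:R; set e := _ * (c j \in L)%:R; field.
Qed.

Lemma same_clusterC {N : nat} {T : finType} (c : 'I_N -> T) (L : {set T}) :
  symmetric (same_cluster c L).
Proof. by move=> i j; rewrite /same_cluster eq_sym; case: eqP => // ->. Qed.

(** Exchanging sums in this rank-one decomposition yields the row totals, and the same decomposition
    yields the covariance matrix of the semidefinite constraint. *)
Lemma same_cluster_sum {R : realType} {N : nat} {T : finType} (c : 'I_N -> T)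
    (L : {set T}) i j :
  (same_cluster c L i j)%:R
  = \sum_(l in L) (c i == l)%:R * (c j == l)%:R :> R.
Proof.
rewrite /same_cluster; case: (boolP (c i \in L)) => ciL; last first.
  rewrite andbF big1 // => l lL; case: eqP => [cl|]; last by rewrite mul0r.
  by rewrite -cl (negbTE ciL) in lL.
rewrite (bigD1 (c i)) //= eqxx mul1r andbT eq_sym big1 ?addr0 //.
by move=> l /andP[_ lci]; rewrite eq_sym (negbTE lci) mul0r.
Qed.

Lemma in_sum {R : realType} {T : finType} (L : {set T}) x :
  (x \in L)%:R = \sum_(l in L) (x == l)%:R :> R.
Proof.
case: (boolP (x \in L)) => xL; last first.
  rewrite big1 // => l lL; case: eqP => // xl.
  by rewrite -xl (negbTE xL) in lL.
rewrite (bigD1 x) //= eqxx big1 ?addr0 //.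
by move=> l /andP[_ lx]; rewrite eq_sym (negbTE lx).
Qed.

Definition clusters_of_size {N : nat} {T : finType} (c : 'I_N -> T)
    (L : {set T}) (n : nat) : Prop :=
  forall l, l \in L -> #|[set i | c i == l]| = n.

Lemma sum_eq_card {R : realType} {N : nat} {T : finType} {c : 'I_N -> T}
    {L : {set T}} {n : nat} :
  clusters_of_size c L n ->
  forall l, l \in L -> \sum_i (c i == l)%:R = n%:R :> R.
Proof.
move=> cn l lL; rewrite -natr_sum -(cn l lL) -sum1dep_card [in RHS]big_mkcond.
by congr _%:R; apply: eq_bigr => i _; case: eqP.
Qed.

Lemma sum_in_clusters {R : realType} {N : nat} {T : finType} {c : 'I_N -> T}
    {L : {set T}} {n : nat} :
  clusters_of_size c L n ->
  \sum_i (c i \in L)%:R = #|L|%:R * n%:R :> R.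
Proof.
move=> cn; under eq_bigr do rewrite in_sum.
rewrite exchange_big /= (eq_bigr (fun=> n%:R)); last exact: sum_eq_card.
by rewrite sumr_const mulr_natl.
Qed.

Lemma sum_same_cluster {R : realType} {N : nat} {T : finType} {c : 'I_N -> T}
    {L : {set T}} {n : nat} :
  clusters_of_size c L n ->
  forall i, \sum_j (same_cluster c L i j)%:R = n%:R * (c i \in L)%:R :> R.
Proof.
move=> cn i; under eq_bigr do rewrite same_cluster_sum.
rewrite exchange_big /= in_sum mulr_sumr; apply: eq_bigr => l lL.
by rewrite -mulr_sumr (sum_eq_card cn) // mulrC.
Qed.

Lemma psd_sum_gram {R : realType} {N : nat} {T : finType} (L : {set T}) (a : R)
    (u : T -> 'cV[R]_N) :
  0 <= a -> psd (a *: \sum_(l in L) u l *m (u l)^T).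
Proof.
move=> a0; split.
  rewrite linearZ linear_sum /=; congr (_ *: _); apply: eq_bigr => l _.
  by rewrite trmx_mul trmxK.
move=> v; rewrite -scalemxAr -scalemxAl mxE mulr_ge0 //.
rewrite mulmx_sumr mulmx_suml summxE sumr_ge0 // => l _.
have -> : v^T *m (u l *m (u l)^T) *m v = (v^T *m u l) *m (v^T *m u l)^T.
  by rewrite trmx_mul trmxK !mulmxA.
by rewrite mxE big_ord1 [X in _ * X]mxE -expr2 sqr_ge0.
Qed.

(** The feasible set is convex and contains, for each cluster of size n, the point x = 2 u_l - 1, M
    = x x^T; hence it contains their average. The constraints are checked directly on the closed
    form. *)
Lemma average_feasible {R : realType} {r : relaxation} {N : nat} {T : finType}
    {c : 'I_N -> T} {L : {set T}} {n : nat} :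
  (0 < #|L|)%N -> clusters_of_size c L n ->
  C_rel r n (average_point c L : rel_var R N).
Proof.
move=> L0 cn; set q : R := #|L|%:R.
have q0 : 0 < q by rewrite ltr0n.
have qN0 : q != 0 by rewrite gt_eqF.
have qi0 : 0 <= q^-1 by rewrite invr_ge0 ltW.
have qi1 : q^-1 <= 1 by rewrite invf_le1 ?q0 // ler1n.
(* Two points in different clusters of [L] force #|L| >= 2, which gives y_i + y_j - 1 <= 0 =
   W_ij. *)
have two i j : c i != c j -> c i \in L -> c j \in L -> 2 * q^-1 <= 1.
  move=> cij iL jL; rewrite ler_pdivrMr // mul1r ler_nat.
  have <- : #|[set c i; c j]| = 2%N by rewrite cards2 cij.
  by apply: subset_leq_card; apply/fintype.subsetP => x; rewrite !inE => /orP[] /eqP->.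
have N0 : \sum_(i < N) (1 : R) = N%:R by rewrite sumr_const card_ord.
split; [|split; [split|split]].
- by apply/matrixP => i j; rewrite !mxE same_clusterC -/q; ring.
- apply/matrixP => i j; rewrite !ord1 !mxE eqxx mulr1n.
  under eq_bigr do rewrite !mxE mul1r.
  rewrite sumrB -!mulr_sumr (sum_in_clusters cn) N0 -/q; field=> //.
- apply/matrixP => i j; rewrite !ord1 !mxE.
  under eq_bigr do rewrite !mxE mulr1.
  rewrite !sumrB big_split /= -!mulr_sumr (sum_in_clusters cn) //.
  rewrite (sum_same_cluster cn) !N0 !sumr_const card_ord.
  by rewrite -[_ *+ N in X in _ - X - _]mulr_natr -/q; field.
- by move=> i; rewrite !mxE /same_cluster eqxx /=; ring.
- case: r => //.
  (* M - x x^T is 4 times the covariance matrix of the u_l. *)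
  pose u l : 'cV[R]_N := \col_i ((c i == l)%:R - q^-1 * (c i \in L)%:R).
  have -> : (average_point c L).2 - (average_point c L).1 *m (average_point c L).1^T
      = (4 * q^-1) *: \sum_(l in L) u l *m (u l)^T; last first.
    by apply: psd_sum_gram; rewrite mulr_ge0.
  apply/matrixP => i j; rewrite !mxE big_ord1 summxE !mxE -/q.
  under [in RHS]eq_bigr do rewrite !mxE big_ord1 !mxE mulrBl !mulrBr.
  rewrite !sumrB -same_cluster_sum -mulr_suml -in_sum -!mulr_sumr -in_sum.
  by rewrite sumr_const -[_ *+ #|L|]mulr_natr -/q; field.
- split=> i j; rewrite !mxE !big_ord1 !mxE -/q /same_cluster;
    case: (boolP (c i \in L)) => iL; case: (boolP (c j \in L)) => jL;
    case: eqP => cij //=; try lra.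
  + by have /eqP cij' := cij; have := two _ _ cij' iL jL; lra.
  all: by rewrite cij (negbTE jL) in iL || rewrite cij jL in iL || lra.
Qed.

(** * Relaxed costs as costs of combined weights *)

(** The differences [g i - f i] are nonnegative with sum 0. Both uniqueness arguments for x rest on
    this. *)
Lemma eq_sum_le {R : realType} {I : finType} {f g : I -> R} :
  (forall i, f i <= g i) -> \sum_i f i = \sum_i g i -> f =1 g.
Proof.
move=> fg sfg i; apply/esym/eqP; rewrite -subr_eq0.
have /eqP : \sum_i (g i - f i) = 0 by rewrite sumrB sfg subrr.
rewrite psumr_eq0 => [/allP/(_ i)|j _]; last by rewrite subr_ge0.
by rewrite mem_index_enum => /(_ isT).
Qed.

(** The totals are those of the same-cluster indicator of q clusters of n points, leaving weight q n
    (n - 1) off the diagonal. *)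
Definition coassignment {R : realType} {N : nat} (V : 'I_N -> 'I_N -> R)
    (q n : nat) : Prop :=
  [/\ forall i j, 0 <= V i j <= 1,
      \sum_i \sum_j V i j = q%:R * n%:R * n%:R &
      \sum_i V i i = q%:R * n%:R].

Lemma coassignment_cost_ge {R : realType} {N n : nat} {T : finType}
    {D : 'M[R]_N} {c : 'I_N -> T} {L : {set T}} {beta : R}
    {V : 'I_N -> 'I_N -> R} :
  clusters_of_size c L n -> well_separated D (same_cluster c L) beta ->
  coassignment V #|L| n ->
  total_cost D (fun i j => (same_cluster c L i j)%:R) <= total_cost D V /\
  (total_cost D V <= total_cost D (fun i j => (same_cluster c L i j)%:R) ->
   forall i j, i != j -> V i j = (same_cluster c L i j)%:R).
Proof.
move=> cn sepD [V01 sumV trV]; apply: total_cost_ge sepD V01 _ _.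
  rewrite sumV; under [in RHS]eq_bigr do rewrite (sum_same_cluster cn).
  by rewrite -mulr_sumr (sum_in_clusters cn) mulrC.
rewrite trV -(sum_in_clusters cn); apply: eq_bigr => i _.
by rewrite /same_cluster eqxx.
Qed.

Lemma mx_innerE {R : realType} {N : nat} (A B : 'M[R]_N) :
  mx_inner A B = total_cost A (fun i j => B j i).
Proof. by rewrite /mx_inner /mxtrace; apply: eq_bigr => i _; rewrite mxE. Qed.

Lemma total_costZ {R : realType} {N : nat} (D : 'M[R]_N) a V :
  total_cost D (fun i j => a * V i j) = a * total_cost D V.
Proof.
rewrite mulr_sumr; apply: eq_bigr => i _; rewrite mulr_sumr.
by apply: eq_bigr => j _; rewrite mulrCA.
Qed.

Lemma eq_total_cost {R : realType} {N : nat} (D : 'M[R]_N) V V' :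
  (forall i j, V i j = V' i j) -> total_cost D V = total_cost D V'.
Proof.
by move=> VV'; apply: eq_bigr => i _; apply: eq_bigr => j _; rewrite VV'.
Qed.

(** The lift is 4 W, so the factor K / (8 n) becomes K / (2 n); the transposed indices come from the
    trace of the product. *)
Lemma Rob_objE {R : realType} {N K n : nat} (D : 'M[R]_N) z :
  Rob_obj K n D z
  = (2 * n%:R)^-1 * total_cost D (fun i j => K%:R * pair_prob z.1 j i).
Proof.
rewrite /Rob_obj mx_innerE -!total_costZ; apply: eq_total_cost => i j.
by rewrite /pair_prob !invfM; set a := n%:R^-1; field.
Qed.

Lemma Rb_objE {R : realType} {N K n : nat} (D : 'M[R]_N) z :
  Rb_obj K n D z
  = (2 * n%:R)^-1 * total_cost D
      (fun i j => pair_prob z.1 j i + (K%:R - 1) * pair_prob z.2 j i).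
Proof.
rewrite /Rb_obj mx_innerE -!total_costZ; apply: eq_total_cost => i j.
have -> : (lift_mx z.1 + (K%:R - 1) *: lift_mx z.2) j i
    = lift_mx z.1 j i + (K%:R - 1) * lift_mx z.2 j i by rewrite !mxE.
by rewrite /pair_prob !invfM; set a := n%:R^-1; field.
Qed.

Lemma prob_x {R : realType} {N : nat} (z : rel_var R N) i :
  z.1 i 0 = 2 * prob z i - 1.
Proof. by rewrite /prob; field. Qed.

Lemma Rob_prob {R : realType} {r : relaxation} {N K n0 n : nat}
    {z : rel_var R N * rel_var R N} :
  Rob_feasible r K n0 n z ->
  forall i, K%:R * prob z.1 i + prob z.2 i = 1.
Proof.
move=> [_ _ eqx] i; have := congr1 (fun A : 'cV_N => A i 0) eqx.
by rewrite !mxE !prob_x => e; lra.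
Qed.

(** The upper bound is K W_ji <= K y_i = 1 - y^0_i <= 1, where y^0_i = W^0_ii is nonnegative. *)
Lemma Rob_coassignment {R : realType} {r : relaxation} {N K n0 n : nat}
    {z : rel_var R N * rel_var R N} :
  (0 < K)%N -> Rob_feasible r K n0 n z ->
  coassignment (fun i j => K%:R * pair_prob z.1 j i) K n.
Proof.
move=> K0 zf; have y1 := Rob_prob zf; case: zf => C1 C0 _.
have [sy sW _ dW bW] := C_relP C1; have [_ _ _ dW0 bW0] := C_relP C0.
have K0R : 0 <= K%:R :> R by [].
split=> [i j||].
- have [W0 _ Wi] := bW j i; rewrite mulr_ge0 //=.
  have [y0 _ _] := bW0 i i; rewrite dW0 in y0.
  by have := ler_wpM2l K0R Wi; have := y1 i; lra.
- under eq_bigr => i _.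
    rewrite -mulr_sumr (_ : \sum_j _ = n%:R * prob z.1 i).
    over.
    by have [_ _ -> _ _] := C_relP C1.
  by rewrite -!mulr_sumr sy mulrA.
- under eq_bigr do rewrite dW.
  by rewrite -mulr_sumr sy.
Qed.

Lemma Rb_prob {R : realType} {r : relaxation} {N K n : nat}
    {z : rel_var R N * rel_var R N} :
  Rb_feasible r K n z ->
  forall i, prob z.1 i + (K%:R - 1) * prob z.2 i = 1.
Proof.
move=> [_ _ eqx _] i; have := congr1 (fun A : 'cV_N => A i 0) eqx.
by rewrite !mxE !prob_x => e; lra.
Qed.

(** The upper bound is W^1_ji + (K - 1) W_ji <= y^1_i + (K - 1) y_i = 1, which uses K >= 1. *)
Lemma Rb_coassignment {R : realType} {r : relaxation} {N K n : nat}
    {z : rel_var R N * rel_var R N} :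
  (0 < K)%N -> Rb_feasible r K n z ->
  coassignment (fun i j => pair_prob z.1 j i + (K%:R - 1) * pair_prob z.2 j i)
    K n.
Proof.
move=> K0 zf; have y1 := Rb_prob zf; case: zf => C1 C2 _ _.
have [sy1 _ cW1 dW1 bW1] := C_relP C1; have [sy2 _ cW2 dW2 bW2] := C_relP C2.
have K0R : 0 <= K%:R - 1 :> R by rewrite subr_ge0 ler1n.
split=> [i j||].
- have [W10 _ W1i] := bW1 j i; have [W20 _ W2i] := bW2 j i.
  have := mulr_ge0 K0R W20; have := ler_wpM2l K0R W2i; have := y1 i.
  by move=> *; apply/andP; split; lra.
- under eq_bigr do rewrite big_split /= -mulr_sumr cW1 cW2.
  by rewrite big_split /= -!mulr_sumr sy1 sy2; ring.
- under eq_bigr do rewrite dW1 dW2.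
  by rewrite big_split /= -!mulr_sumr sy1 sy2; ring.
Qed.

(** * Feasible averages, and minimizers of the balanced relaxation *)

(** With o the outlier label, K y is the inlier indicator and y^0 the outlier indicator, so they add
    up to 1. *)
Lemma average_Rob_feasible {R : realType} {r : relaxation} {N n0 n : nat}
    {T : finType} {c : 'I_N -> T} {o : T} :
  (0 < #|[set~ o]|)%N ->
  clusters_of_size c [set~ o] n -> clusters_of_size c [set o] n0 ->
  Rob_feasible r #|[set~ o]| n0 n
    (average_point c [set~ o] : rel_var R N, average_point c [set o]).
Proof.
move=> K0 cn cn0; split=> /=; first exact: average_feasible.
  by apply: average_feasible; rewrite ?cards1.
have qN0 : #|[set~ o]|%:R != 0 :> R by rewrite pnatr_eq0 -lt0n.
apply/matrixP => i j; rewrite !mxE cards1 !inE.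
by case: (c i == o) => /=; field.
Qed.

(** The cluster of the first point is used unaveraged, which gives x^1_1 = 1; the other clusters
    share one average. *)
Lemma average_Rb_feasible {R : realType} {r : relaxation} {N n : nat}
    {T : finType} {c : 'I_N -> T} {L : {set T}} {l : T} :
  clusters_of_size c L n -> (forall i, c i \in L) -> l \in L -> (1 < #|L|)%N ->
  (forall i : 'I_N, i = 0%N :> nat -> c i = l) ->
  Rb_feasible r #|L| n
    (average_point c [set l] : rel_var R N, average_point c (L :\ l)).
Proof.
move=> cn cL lL L1 c0; have Ll : #|L| = #|L :\ l|.+1 by rewrite (cardsD1 l) lL.
have q0 : (0 < #|L :\ l|)%N by rewrite -ltnS -Ll.
have qN0 : #|L :\ l|%:R != 0 :> R by rewrite pnatr_eq0 -lt0n.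
split=> /=.
- by apply: average_feasible => [|k]; rewrite ?cards1 // inE => /eqP->; exact: cn.
- by apply: average_feasible => // k; rewrite inE => /andP[_]; exact: cn.
- apply/matrixP => i j; rewrite !mxE Ll cards1 !inE cL -natr1.
  by case: (c i == l) => /=; field.
- by move=> i /c0 ci; rewrite !mxE cards1 !inE ci eqxx /=; field.
Qed.

Lemma average_Rb_cost {R : realType} {N n : nat} {T : finType} {D : 'M[R]_N}
    {c : 'I_N -> T} {L : {set T}} {l : T} :
  l \in L -> (1 < #|L|)%N ->
  Rb_obj #|L| n D (average_point c [set l], average_point c (L :\ l))
  = (2 * n%:R)^-1 * total_cost D (fun i j => (same_cluster c L i j)%:R).
Proof.
move=> lL L1; have Ll : #|L| = #|L :\ l|.+1 by rewrite (cardsD1 l) lL.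
have q0 : (0 < #|L :\ l|)%N by rewrite -ltnS -Ll.
have qN0 : #|L :\ l|%:R != 0 :> R by rewrite pnatr_eq0 -lt0n.
rewrite Rb_objE; congr (_ * _); apply: eq_total_cost => i j.
rewrite !pair_prob_average cards1 Ll -(natr1 #|_|) addrK mulrA divff // invr1 !mul1r.
rewrite (same_clusterC c L) /same_cluster !inE.
case: (c j == c i); rewrite /= ?addr0 //.
by case: eqP => [->|] /=; rewrite ?lL ?addr0 ?add0r.
Qed.

Lemma is_minimizer_le {R : realType} {T : Type} {feas : set T} {obj : T -> R}
    {z z' : T} :
  is_minimizer feas obj z -> feas z' -> obj z <= obj z'.
Proof. by case=> _; apply. Qed.

Lemma Rb_cost_ge {R : realType} {r : relaxation} {N n : nat}
    {T : finType} {D : 'M[R]_N} {c : 'I_N -> T} {L : {set T}} {beta : R}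
    {z : rel_var R N * rel_var R N} :
  (0 < n)%N -> (1 < #|L|)%N -> clusters_of_size c L n ->
  well_separated D (same_cluster c L) beta -> Rb_feasible r #|L| n z ->
  (2 * n%:R)^-1 * total_cost D (fun i j => (same_cluster c L i j)%:R)
    <= Rb_obj #|L| n D z /\
  (Rb_obj #|L| n D z <=
     (2 * n%:R)^-1 * total_cost D (fun i j => (same_cluster c L i j)%:R) ->
   forall i j, i != j ->
     pair_prob z.1 j i + (#|L|%:R - 1) * pair_prob z.2 j i
     = (same_cluster c L i j)%:R).
Proof.
move=> n0 L1 cn sepD /(Rb_coassignment (ltnW L1)).
move=> /(coassignment_cost_ge cn sepD)[ge eq].
have n2 : 0 < (2 * n%:R)^-1 :> R by rewrite invr_gt0 mulr_gt0 ?ltr0n.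
by rewrite Rb_objE; split; rewrite ler_pM2l.
Qed.

(* At the optimum the first point shares no weight with other clusters, so the
   row of W^1 belonging to it fills up its own cluster, which has exactly [n]
   points. *)
Lemma Rb_minimizer_x {R : realType} {r : relaxation} {N n : nat}
    {T : finType} {D : 'M[R]_N} {c : 'I_N -> T} {L : {set T}} {beta : R}
    {z : rel_var R N * rel_var R N} {i0 : 'I_N} :
  (0 < n)%N -> (1 < #|L|)%N -> clusters_of_size c L n ->
  (forall i, c i \in L) -> well_separated D (same_cluster c L) beta ->
  i0 = 0%N :> nat ->
  is_minimizer (Rb_feasible r #|L| n) (Rb_obj #|L| n D) z ->
  forall i, z.1.1 i 0 = 2 * (c i == c i0)%:R - 1.
Proof.
move=> n0 L1 cn cL sepD i00 zmin i; rewrite prob_x; congr (2 * _ - 1); move: i.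
have zf : Rb_feasible r #|L| n z by case: zmin.
have [_ /(_ _) eqV] := Rb_cost_ge n0 L1 cn sepD zf.
have c0 (i : 'I_N) : i = 0%N :> nat -> c i = c i0.
  by move=> i_0; congr c; apply: val_inj; rewrite /= i_0 i00.
have := is_minimizer_le zmin (average_Rb_feasible cn cL (cL i0) L1 c0).
rewrite (average_Rb_cost (cL i0) L1) => /eqV{}eqV.
have [C1 C2 _ x0] := zf.
have [sy1 rW1 _ _ bW1] := C_relP C1; have [_ _ _ _ bW2] := C_relP C2.
have K1 : 0 <= #|L|%:R - 1 :> R by rewrite subr_ge0 ler1n ltnW.
have y0 : prob z.1 i0 = 1 by rewrite /prob x0 // divff.
have sc : \sum_i (c i == c i0)%:R = n%:R :> R by apply: sum_eq_card cn _ (cL i0).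
(* Outside the cluster of [i0] the two nonnegative terms of V add up to 0; inside, W^1 is at most
   y^1 at [i0], which is 1. Both sides total n. *)
have W0 : (pair_prob z.1 i0) =1 (fun j => (c j == c i0)%:R).
  apply: eq_sum_le => [j|]; last by rewrite rW1 y0 sc mulr1.
  have [W10 W1i _] := bW1 i0 j; have [W20 _ _] := bW2 i0 j.
  case: (boolP (c j == c i0)) => cj; first by rewrite -y0.
  have ji : j != i0 by apply: contra cj => /eqP->.
  have := eqV _ _ ji; rewrite /same_cluster (negbTE cj) /=.
  by move=> /eqP; rewrite paddr_eq0 ?(mulr_ge0 K1 W20) // => /andP[/eqP->].
(* Row [i0] of W^1, now known to be the cluster indicator, lies below y^1, and both sum to n. *)
apply/fsym/eq_sum_le => [j|]; last by rewrite sc sy1.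
by rewrite -W0; have [] := bW1 i0 j.
Qed.

(** * Sorting and the extraction of one cluster *)

Lemma sorts_decreasingly_ex {R : realType} {N : nat} (x : 'cV[R]_N) :
  exists rho, sorts_decreasingly x rho.
Proof.
pose le (i j : 'I_N) := x j 0 <= x i 0.
have le_total : total le by move=> i j; exact: le_total.
have le_tr : transitive le by move=> j i k ji kj; exact: le_trans kj ji.
pose s := sort le (enum 'I_N).
have size_s : size s = N by rewrite size_sort size_enum_ord.
(* The default [a] of [nth] is never reached since [s] has size N; taking it from the argument
   covers N = 0. *)
have inj_f : injective (fun a : 'I_N => nth a s a).
  move=> a b; rewrite (set_nth_default b) ?size_s // => /eqP.
  rewrite nth_uniq ?size_s // ?sort_uniq ?enum_uniq // => /eqP ab.
  exact: val_inj.
exists (perm inj_f) => a b ab; rewrite !permE (set_nth_default b a) ?size_s //.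
apply: (@sorted_leq_nth _ le le_tr _ b s (sort_sorted le_total _)) => //;
  by rewrite ?inE ?size_s // => i; exact: lexx.
Qed.

(** If position a holds a point outside A, the strict gap places all of A before a, so #|A| <= a.
    Hence the prefix lies in A, and equal cardinalities conclude. *)
Lemma sorted_prefix {R : realType} {N : nat} {x : 'cV[R]_N} {rho : 'S_N}
    {A : {set 'I_N}} :
  sorts_decreasingly x rho ->
  (forall i j, i \in A -> j \notin A -> x j 0 < x i 0) ->
  [set rho a | a : 'I_N & (a < #|A|)%N]%SET = A.
Proof.
move=> srt ltA; have AN : (#|A| <= N)%N by rewrite -[leqRHS]card_ord max_card.
have card_lt m : (m <= N)%N -> #|[set a : 'I_N | (a < m)%N]| = m.
  move=> mN; have inj_w : injective (widen_ord mN).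
    by move=> a b /(congr1 val) /= ab; exact: val_inj.
  rewrite -[RHS](card_ord m) -(card_imset _ inj_w).
  apply: eq_card => a; rewrite inE; apply/idP/imsetP => [am|[b _ ->] /=].
    by exists (Ordinal am) => //; apply: val_inj.
  exact: ltn_ord.
apply/eqP; rewrite eqEcard card_imset ?card_lt ?leqnn ?andbT //; last exact: perm_inj.
apply/fintype.subsetP => _ /imsetP[a + ->]; rewrite inE; apply: contraLR => rhoA.
rewrite -leqNgt -(card_lt a (ltnW (ltn_ord a))).
rewrite -(card_imset [set b : 'I_N | (b < a)%N] (@perm_inj _ rho)).
apply/subset_leq_card/fintype.subsetP => i iA; apply/imsetP.
exists ((rho^-1)%g i); rewrite ?permKV // inE ltnNge; apply/negP => /srt.
by rewrite permKV leNgt ltA.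
Qed.

Lemma card_labelled {N n : nat} {T : finType} {c : 'I_N -> T} {L : {set T}} :
  clusters_of_size c L n -> #|[set i | c i \in L]| = (#|L| * n)%N.
Proof.
move=> cn; rewrite -sum1dep_card (partition_big c (mem L)) //=.
rewrite -sum_nat_const; apply: eq_bigr => l lL.
rewrite -(cn l lL) -sum1dep_card; apply: eq_bigl => i.
by case: eqP => [->|]; rewrite ?andbT ?andbF.
Qed.

Lemma clusters_of_size_restrict {N n : nat} {T : finType} {c : 'I_N -> T}
    {L : {set T}} {S : {set 'I_N}} :
  S = [set i | c i \in L] -> clusters_of_size c L n ->
  clusters_of_size (fun a : 'I_#|S| => c (enum_val a)) L n.
Proof.
move=> S_def cn l lL; rewrite -(cn l lL) -(card_imset _ enum_val_inj).
apply: eq_card => i; rewrite !inE; apply/imsetP/eqP => [[a + ->]|ci].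
  by rewrite inE => /eqP.
have iS : i \in S by rewrite S_def inE ci.
by exists (enum_rank_in iS i); rewrite ?inE enum_rankK_in // ci.
Qed.

(** All points of [S] have labels in [L'], so separate clusters stay separate; one threshold serves
    every call of the subroutine. *)
Lemma well_separated_restrict {R : realType} {N : nat} {T : finType}
    {D : 'M[R]_N} {c : 'I_N -> T} {L L' : {set T}} {beta : R} {S : {set 'I_N}} :
  L' \subset L -> S = [set i | c i \in L'] ->
  well_separated D (same_cluster c L) beta ->
  well_separated (restrict_mx D S)
    (same_cluster (fun a : 'I_#|S| => c (enum_val a)) L') beta.
Proof.
move=> /fintype.subsetP L'L S_def [D0 Dle Dgt]; split=> [a|a b|a b ab].
- by rewrite mxE D0.
- by rewrite mxE => /andP[ab aL]; rewrite Dle // /same_cluster ab L'L.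
- have aL' : c (enum_val a) \in L'.
    suff : enum_val a \in [set i | c i \in L'] by rewrite inE.
    by rewrite -S_def enum_valP.
  rewrite mxE /same_cluster aL' andbT => cab; apply: Dgt.
    by apply: contra ab => /eqP/enum_val_inj->.
  by rewrite /same_cluster (negbTE cab).
Qed.


(** At any minimizer x^1 is 1 on the cluster of the first remaining point and -1 elsewhere, so every
    sorting lists that cluster first. *)
Lemma extracts_cluster_label {R : realType} {r : relaxation} {N n : nat}
    {T : finType} {D : 'M[R]_N} {c : 'I_N -> T} {L L' : {set T}} {beta : R}
    {I : {set 'I_N}} :
  (0 < n)%N -> L' \subset L -> (1 < #|L'|)%N -> clusters_of_size c L n ->
  well_separated D (same_cluster c L) beta ->
  extracts_cluster D r n [set i | c i \in L'] I ->
  exists2 l, l \in L' & I = [set i | c i == l].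
Proof.
move=> n0 LL L1 cn sepD [z [rho []]].
have cn' : clusters_of_size c L' n.
  by move=> l /(fintype.subsetP LL); exact: cn.
move: z rho; set S := [set i | c i \in L'] => z rho.
have cS : #|S| = (#|L'| * n)%N := card_labelled cn'.
have -> : (#|S| %/ n = #|L'|)%N by rewrite cS mulnK.
move=> zmin srt ->.
have cn1 := clusters_of_size_restrict (erefl S) cn'.
have sep1 := well_separated_restrict LL (erefl S) sepD.
have S0 : (0 < #|S|)%N by rewrite cS muln_gt0 n0 ltnW.
pose c' (a : 'I_#|S|) := c (enum_val a).
have c'L a : c' a \in L' by have := enum_valP a; rewrite inE.
have xE := Rb_minimizer_x n0 L1 cn1 c'L sep1 (erefl : Ordinal S0 = 0%N :> nat) zmin.
exists (c' (Ordinal S0)) => //.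
have cA : #|[set a | c' a == c' (Ordinal S0)]| = n by apply: cn1.
have := @sorted_prefix _ _ _ _ [set a | c' a == c' (Ordinal S0)] srt.
rewrite cA => srtA.
rewrite imset_comp srtA; last first.
  move=> a b; rewrite !inE => /eqP ca /negbTE cb.
  by rewrite !xE -/(c' a) -/(c' b) -/(c' (Ordinal S0)) ca eqxx cb /=; lra.
apply/setP => i; rewrite inE; apply/imsetP/eqP => [[a + ->]|ci].
  by rewrite inE => /eqP.
have iS : i \in S by rewrite inE ci.
by exists (enum_rank_in iS i); rewrite ?inE /c' enum_rankK_in // ci.
Qed.

(** The averages built from the label of the first remaining point attain the lower bound on the
    cost. *)
Lemma extracts_cluster_ex {R : realType} {r : relaxation} {N n : nat}
    {T : finType} {D : 'M[R]_N} {c : 'I_N -> T} {L L' : {set T}} {beta : R} :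
  (0 < n)%N -> L' \subset L -> (1 < #|L'|)%N -> clusters_of_size c L n ->
  well_separated D (same_cluster c L) beta ->
  exists I, extracts_cluster D r n [set i | c i \in L'] I.
Proof.
move=> n0 LL L1 cn sepD.
have cn' : clusters_of_size c L' n.
  by move=> l /(fintype.subsetP LL); exact: cn.
set S := [set i | c i \in L'].
have cS : #|S| = (#|L'| * n)%N := card_labelled cn'.
have cn1 := clusters_of_size_restrict (erefl S) cn'.
have sep1 := well_separated_restrict LL (erefl S) sepD.
have S0 : (0 < #|S|)%N by rewrite cS muln_gt0 n0 ltnW.
pose c' (a : 'I_#|S|) := c (enum_val a).
have c'L a : c' a \in L' by have := enum_valP a; rewrite inE.
pose l := c' (Ordinal S0).
pose z : rel_var R #|S| * rel_var R #|S| :=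
  (average_point c' [set l], average_point c' (L' :\ l)).
have [rho srt] := sorts_decreasingly_ex z.1.1.
exists [set enum_val (rho a) | a : 'I_#|S| & (a < n)%N]%SET, z, rho; split=> //.
have -> : (#|S| %/ n = #|L'|)%N by rewrite cS mulnK.
split.
  apply: average_Rb_feasible cn1 c'L (c'L _) L1 _ => a a0.
  by congr c'; exact: val_inj.
move=> z' /(Rb_cost_ge n0 L1 cn1 sep1)[+ _].
by rewrite (average_Rb_cost (c'L _) L1).
Qed.

(** * Runs of the balanced subroutine *)

(** Loop invariant: each extraction removes exactly one label, and m - 1 of them precede step m. *)
Lemma remaining_labels {R : realType} {r : nat -> relaxation} {N n m : nat}
    {T : finType} {D : 'M[R]_N} {c : 'I_N -> T} {L : {set T}} {beta : R}
    {cI I : nat -> {set 'I_N}} :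
  (0 < n)%N -> clusters_of_size c L n ->
  well_separated D (same_cluster c L) beta ->
  cI 1%N = [set i | c i \in L] -> (0 < m <= #|L|)%N ->
  (forall k, (0 < k < m)%N ->
     extracts_cluster D (r k) n (cI k) (I k) /\ cI k.+1 = cI k :\: I k) ->
  exists2 L' : {set T}, L' \subset L /\ (#|L'| + m)%N = #|L|.+1
    & cI m = [set i | c i \in L'].
Proof.
move=> n0 cn sepD cI1; elim: m => // m IH mL step.
case: m => [|m] in IH mL step *; first by exists L; rewrite ?addn1.
have [|k /andP[k0 km]|L' [L'L cL'] cI'] := IH.
- exact: leq_trans mL.
- by apply: step; rewrite k0 ltnW.
have [ext ->] := step m.+1 (leqnn _).
have L'1 : (1 < #|L'|)%N by lia.
rewrite cI' in ext *.
have [l lL' ->] := extracts_cluster_label n0 L'L L'1 cn sepD ext.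
exists (L' :\ l); last by apply/setP => i; rewrite !inE.
by split; [exact: fintype.subset_trans (subsetDl _ _) L'L|
           rewrite -cL' (cardsD1 l L') lL'; lia].
Qed.

Lemma card_setC1_ord0 (K : nat) : #|[set~ ord0 : 'I_K.+1]| = K.
Proof. by rewrite cardsC1 card_ord. Qed.

(** Each output set is the cluster of one label. Later sets avoid earlier ones, so the labels are
    distinct and form a permutation. *)
Lemma balanced_rounding_relabels {R : realType} {r : nat -> relaxation}
    {N K n : nat} {D : 'M[R]_N} {c : 'I_N -> 'I_K.+1} {beta : R}
    {I : 'I_K.+1 -> {set 'I_N}} :
  (0 < K)%N -> (0 < n)%N -> clusters_of_size c [set~ ord0] n ->
  well_separated D (same_cluster c [set~ ord0]) beta ->
  I ord0 = [set i | c i == ord0] ->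
  balanced_rounding D r n [set i | c i \in [set~ ord0]] I ->
  equal_up_to_relabeling I (fun k => [set i | c i == k]).
Proof.
move=> K0 n0 cn sepD I0 [cI [cI1 step IK]].
(* The loop invariant is indexed by naturals and the output by ordinals; [inord] is faithful up to
   K. *)
have inE' (k : nat) : (k <= K)%N -> (inord k : 'I_K.+1) = k :> nat.
  by move=> kK; rewrite inordK.
have remain m : (0 < m <= K)%N -> exists2 L' : {set 'I_K.+1},
    L' \subset [set~ ord0] /\ (#|L'| + m)%N = K.+1
    & cI m = [set i | c i \in L'].
  move=> /andP[m0 mK].
  have := remaining_labels (m := m) (r := r) (I := fun k => I (inord k))
    n0 cn sepD cI1.
  rewrite card_setC1_ord0; apply; first by rewrite m0.
  move=> k /andP[k0 km]; have kK : (k < K)%N := leq_trans km mK.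
  by have := step (inord k); rewrite inE' ?(ltnW kK) // k0 kK; apply.
have label (k : 'I_K.+1) : exists l, (l == ord0) = (k == ord0) /\
    I k = [set i | c i == l].
  have [->|k_neq0] := eqVneq k ord0; first by exists ord0; rewrite eqxx.
  have k0 : (0 < k)%N by rewrite lt0n.
  have [|L' [L'L cL'] cI'] := remain k; first by rewrite k0 -ltnS ltn_ord.
  suff [l lL' ->] : exists2 l, l \in L' & I k = [set i | c i == l].
    exists l; split=> //; have := fintype.subsetP L'L l lL'.
    by rewrite !inE => /negbTE.
  have [kK|Kk] := ltnP k K.
    have [|ext _] := step k; first by rewrite k0.
    rewrite cI' in ext; apply: extracts_cluster_label n0 L'L _ cn sepD ext.
    by lia.
  have kK : k = K :> nat by apply/eqP; rewrite eqn_leq Kk -ltnS ltn_ord.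
  have k_max : k = ord_max by apply: val_inj.
  (* At the final index a single label is left, and the last cluster is everything that remains. *)
  have /eqP/cards1P[l L'l] : #|L'| = 1%N by lia.
  exists l; first by rewrite L'l inE.
  rewrite {1}k_max IK (_ : cI K = cI k); last by rewrite kK.
  by rewrite cI' L'l; apply/setP => i; rewrite !inE.
have [s sP] := fin_all_exists label.
have disj (k k' : 'I_K.+1) : (k < k')%N -> s k != s k'.
  move=> kk'; apply/eqP => skk'; have [s0 Ik] := sP k; have [s0' Ik'] := sP k'.
  have k'0 : k' != ord0 by rewrite -lt0n (leq_trans _ kk').
  have k0 : k != ord0 by rewrite -s0 skk' s0'.
  have k_gt0 : (0 < k)%N by rewrite lt0n.
  (* Points extracted at step k never return to the remaining set. *)
  have sub (j : nat) : (k < j <= K)%N -> [disjoint cI j & I k].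
    elim: j => // j IH /andP[kj jK].
    have [|_] := step (inord j); rewrite inE' ?(ltnW jK) //.
      by rewrite jK andbT -ltnS (leq_ltn_trans k_gt0).
    move: kj; rewrite ltnS leq_eqVlt => /orP[/eqP kj|kj] ->.
      rewrite (_ : inord j = k); last by apply: val_inj; rewrite /= inE' ?(ltnW jK).
      by rewrite finset.disjoints_subset finset.subsetDr.
    by apply: disjointWl (subsetDl _ _) (IH _); rewrite kj ltnW.
  have k'K : (k' <= K)%N by rewrite -ltnS ltn_ord.
  have I_sub : I k' \subset cI k'.
    have [k'ltK|Kk'] := ltnP k' K.
      have [|ext _] := step k'; first by rewrite lt0n k'0.
      have [|L' [L'L cL'] cI'] := remain k'; first by rewrite lt0n k'0.
      rewrite cI' in ext *.
      have [|l lL' ->] := extracts_cluster_label n0 L'L _ cn sepD ext.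
        by lia.
      by apply/fintype.subsetP => i; rewrite !inE => /eqP->.
    have k'E : k' = K :> nat by apply/eqP; rewrite eqn_leq k'K.
    by rewrite (_ : k' = ord_max) ?IK //; apply: val_inj.
  have /(disjointWl I_sub) : [disjoint cI k' & I k] by apply: sub; rewrite kk'.
  (* With equal labels the two disjoint sets would be the same cluster, hence empty, against n >
     0. *)
  rewrite Ik Ik' skk' -finset.setI_eq0 finset.setIid.
  move=> /eqP/(congr1 (fun A : {set _} => #|A|)).
  by rewrite cn ?cards0 ?inE ?s0' // => nE; rewrite nE in n0.
have s_inj : injective s.
  move=> k k' skk'; apply/val_inj/eqP; case: ltngtP => // /disj.
    by rewrite skk' eqxx.
  by rewrite skk' eqxx.
exists (perm s_inj); split=> [|k]; rewrite permE; last by have [] := sP k.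
by apply/eqP; have [-> _] := sP ord0.
Qed.

Lemma balanced_rounding_ex {R : realType} {r : nat -> relaxation}
    {N K n : nat} {D : 'M[R]_N} {c : 'I_N -> 'I_K.+1} {beta : R}
    (I0 : {set 'I_N}) :
  (0 < K)%N -> (0 < n)%N -> clusters_of_size c [set~ ord0] n ->
  well_separated D (same_cluster c [set~ ord0]) beta ->
  exists I : 'I_K.+1 -> {set 'I_N}, I ord0 = I0 /\
    balanced_rounding D r n [set i | c i \in [set~ ord0]] I.
Proof.
move=> K0 n0 cn sepD; set S := finset.finset _.
(* Chooses one possible extraction, with the empty set as default; [extP] shows that a genuine one
   is chosen at each step of the loop. *)
pose ext k A := xget finset.set0 (fun I : {set 'I_N} => extracts_cluster D (r k) n A I).
(* The recursion effectively starts at index 1, so indices 0 and 1 both give [S]. *)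
pose fix cI k : {set 'I_N} :=
  if k is k'.+1 then if k' is 0 then S else cI k' :\: ext k' (cI k') else S.
have cIS k : (0 < k)%N -> cI k.+1 = cI k :\: ext k (cI k) by case: k.
have extP k : (0 < k < K)%N -> extracts_cluster D (r k) n (cI k) (ext k (cI k)).
  (* An extraction exists at step k only because all earlier ones were genuine, hence strong
     induction. *)
  elim/ltn_ind: k => k IH /andP[k0 kK].
  have [||L' [L'L cL'] cI'] := remaining_labels (m := k) (r := r)
      (I := fun k => ext k (cI k)) n0 cn sepD (erefl : cI 1%N = S).
  - by rewrite k0 card_setC1_ord0 ltnW.
  - move=> j /andP[j0 jk]; split; last exact: cIS.
    by apply: IH => //; rewrite j0 (ltn_trans jk).
  rewrite card_setC1_ord0 in cL'.
  apply: (@xgetPex _ finset.set0 (fun I => extracts_cluster D (r k) n (cI k) I)).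
  rewrite cI'; apply: extracts_cluster_ex n0 L'L _ cn sepD.
  by lia.
exists (fun k => if k == ord0 then I0
                 else if (k < K)%N then ext k (cI k) else cI K).
rewrite eqxx; split=> //; exists cI; split=> // [k /andP[k0 kK]|].
  rewrite -(inj_eq val_inj) /= gtn_eqF // kK.
  by split; [apply: extP; rewrite k0|exact: cIS].
by rewrite -(inj_eq val_inj) /= gtn_eqF // ltnn.
Qed.

(** * Label functions and the separation threshold *)

Lemma clustering_label {N K : nat} {J : 'I_K.+1 -> {set 'I_N}} :
  is_clustering J ->
  exists c : 'I_N -> 'I_K.+1, J = fun k => [set i | c i == k].
Proof.
move=> [disj cover].
have label i : exists k, i \in J k.
  have : i \in \bigcup_(k < K.+1) J k by rewrite cover inE.
  by move=> /bigcupP[k _ ik]; exists k.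
have [c cP] := fin_all_exists label.
exists c; apply/funext => k; apply/setP => i; rewrite inE.
apply/idP/eqP => [ik|<-//]; apply/eqP; apply: contraT => cik.
by have /disjointFr/(_ (cP i)) := disj _ _ cik; rewrite ik.
Qed.

(** The threshold is the largest within-cluster distance. It is finite: the clustered point [i0]
    excludes -oo, and lying strictly below a minimum excludes +oo. *)
Lemma well_separated_clustering {R : realType} {N K : nat} {D : 'M[R]_N}
    {c : 'I_N -> 'I_K.+1} {i0 : 'I_N} :
  let J k := [set i | c i == k] in
  (forall i, D i i = 0) -> (forall i j, D i j = D j i) -> c i0 != ord0 ->
  (max_within D J < min_between D J)%E ->
  (max_within D J < min_outlier D J)%E ->
  exists beta, well_separated D (same_cluster c [set~ ord0]) beta.
Proof.
move=> J D0 Dsym ci0 between outlier.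
have le_within i j : same_cluster c [set~ ord0] i j ->
    ((D i j)%:E <= max_within D J)%E.
  move=> /andP[/eqP cij]; rewrite !inE => ci.
  apply: (bigmax_sup (c i)) => //; apply: (bigmax_sup i); first by rewrite inE.
  by apply: (bigmax_sup j); rewrite ?inE ?cij.
have fin_within : max_within D J \is a fin_num.
  rewrite fin_numElt (lt_le_trans _ (le_within i0 i0 _)) ?ltNyr //=; last first.
    by rewrite /same_cluster eqxx !inE ci0.
  exact: lt_le_trans between (leey _).
exists (fine (max_within D J)); split=> // i j.
  by move=> /le_within; rewrite -lee_fin fineK.
move=> ij cij; rewrite -lte_fin fineK //.
have far_outlier (i' j' : 'I_N) : i' != j' -> c i' = ord0 ->
    (max_within D J < (D i' j')%:E)%E.
  move=> ij' ci'; apply: lt_le_trans outlier _.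
  apply: (bigmin_inf i'); first by rewrite inE ci'.
  by apply: (bigmin_inf j'); rewrite // eq_sym.
have far_between (i' j' : 'I_N) : (c i' < c j')%N -> c i' != ord0 ->
    (max_within D J < (D i' j')%:E)%E.
  move=> ij' ci'; apply: lt_le_trans between _.
  apply: (bigmin_inf (c i')) => //; apply: (bigmin_inf (c j')) => //.
  by apply: (bigmin_inf i'); rewrite ?inE //; apply: (bigmin_inf j'); rewrite ?inE.
(* Symmetry of [D] covers an outlier in second place and labels in decreasing order, since the
   minimum between clusters ranges over k1 < k2. *)
have [ci|ci] := eqVneq (c i) ord0; first exact: far_outlier.
have [cj|cj] := eqVneq (c j) ord0; first by rewrite Dsym far_outlier // eq_sym.
have := cij; rewrite /same_cluster !inE ci andbT => cij'.
case: (ltngtP (c i) (c j)) => cc; first exact: far_between.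
  by rewrite Dsym far_between.
by rewrite (val_inj cc) eqxx in cij'.
Qed.

(** * The assignment problem *)

Lemma Po_objE {R : realType} {N K n0 n : nat} {D : 'M[R]_N} {z : Po_var R N K} :
  Po_obj D (cluster_sizes n0 n) z
  = (2 * n%:R)^-1 * total_cost D (fun i j => \sum_(k in [set~ ord0]) z.2 k i j).
Proof.
rewrite /Po_obj invfM -mulrA; congr (_ * _); rewrite -total_costZ.
rewrite (eq_bigr (fun k => \sum_i \sum_j D i j * (n%:R^-1 * z.2 k i j))); last first.
  move=> k /negbTE k0; rewrite /cluster_sizes k0 mulr_sumr.
  apply: eq_bigr => i _; rewrite mulr_sumr; apply: eq_bigr => j _.
  by rewrite mulrCA.
rewrite exchange_big; apply: eq_bigr => i _; rewrite exchange_big.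
apply: eq_bigr => j _; rewrite !mulr_sumr.
by apply: eq_bigl => k; rewrite !inE.
Qed.

Lemma Po_of_clusteringE {R : realType} {N K : nat} {c : 'I_N -> 'I_K.+1} k i j :
  (Po_of_clustering R (fun k => [set i | c i == k])).2 k i j
  = (c i == k)%:R * (c j == k)%:R.
Proof.
rewrite /= !mxE !inE; case: (c i == k); case: (c j == k) => /=;
  rewrite ?mul1r ?mul0r ?addrK ?add0r ?addr0 ?subrr ?maxxx //.
- by apply/max_idPl.
- by apply/max_idPr; rewrite lerN10.
Qed.

Lemma Po_of_clustering_feasible {R : realType} {N K n0 n : nat}
    {c : 'I_N -> 'I_K.+1} :
  clusters_of_size c [set~ ord0] n -> clusters_of_size c [set ord0] n0 ->
  Po_feasible (cluster_sizes n0 n)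
    (Po_of_clustering R (fun k => [set i | c i == k])).
Proof.
move=> cn cn0; do ![split] => [i k|k i j|k|i|k i j].
- by rewrite mxE; case: (i \in _); [right|left].
- by rewrite mxE le_max lexx orbT.
- under eq_bigr do rewrite mxE inE.
  rewrite /cluster_sizes; case: ifPn => k0.
    by rewrite (sum_eq_card cn0) // inE.
  by rewrite (sum_eq_card cn) // !inE.
- under eq_bigr do rewrite mxE inE.
  rewrite (bigD1 (c i)) //= eqxx big1 ?addr0 // => k.
  by rewrite eq_sym => /negbTE->.
- by rewrite [X in _ <= X]mxE le_max lexx.
Qed.

(** On 0/1 values eta dominates the product of the two assignments. As [D] is nonnegative, replacing
    eta by these products does not raise the cost, and their sum over the clusters k >= 1 is a
    coassignment. *)
Lemma Po_cost_ge {R : realType} {N K n0 n : nat} {D : 'M[R]_N}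
    {c : 'I_N -> 'I_K.+1} {beta : R} {z : Po_var R N K} :
  (forall i j, 0 <= D i j) -> clusters_of_size c [set~ ord0] n ->
  well_separated D (same_cluster c [set~ ord0]) beta ->
  Po_feasible (cluster_sizes n0 n) z ->
  (2 * n%:R)^-1
    * total_cost D (fun i j => (same_cluster c [set~ ord0] i j)%:R)
  <= Po_obj D (cluster_sizes n0 n) z.
Proof.
case: z => p eta D_ge0 cn sepD [p01 [eta0 [psize [psum etap]]]].
rewrite Po_objE ler_wpM2l ?invr_ge0 ?mulr_ge0 //.
pose V i j := \sum_(k in [set~ ord0]) p i k * p j k.
have p0 i k : 0 <= p i k by case: (p01 i k) => ->.
have p1 i k : p i k <= 1 by case: (p01 i k) => ->.
have sizeE k : k \in [set~ ord0] -> \sum_i p i k = n%:R.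
  by rewrite !inE psize /cluster_sizes => /negbTE->.
have coV : coassignment V #|[set~ ord0 : 'I_K.+1]| n.
  split=> [i j||].
  - rewrite /V sumr_ge0 /= => [|k _]; last exact: mulr_ge0.
    rewrite -(psum i) [leLHS]big_mkcond ler_sum //= => k _.
    by case: ifP => // _; rewrite ler_piMr.
  - transitivity (\sum_i \sum_(k in [set~ ord0 : 'I_K.+1]) p i k * n%:R).
      apply: eq_bigr => i _; rewrite exchange_big; apply: eq_bigr => k k0.
      by rewrite -mulr_sumr sizeE.
    rewrite exchange_big (eq_bigr (fun=> n%:R * n%:R)) => [|k k0]; last first.
      by rewrite -mulr_suml sizeE.
    by rewrite sumr_const -[LHS]mulr_natl mulrA.
  - rewrite exchange_big (eq_bigr (fun=> n%:R)) => [|k k0]; last first.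
      rewrite -(sizeE k k0); apply: eq_bigr => i _.
      by case: (p01 i k) => ->; rewrite ?mul0r ?mul1r.
    by rewrite sumr_const mulr_natl.
have [+ _] := coassignment_cost_ge cn sepD coV; move=> /le_trans; apply.
rewrite !ler_sum // => i _; rewrite ler_sum // => j _; rewrite ler_wpM2l //.
rewrite ler_sum // => k _ /=; have := etap k i j; have := eta0 k i j.
by case: (p01 i k) => ->; case: (p01 j k) => ->; lra.
Qed.

Lemma Po_of_clustering_cost {R : realType} {N K n0 n : nat} {D : 'M[R]_N}
    {c : 'I_N -> 'I_K.+1} :
  Po_obj D (cluster_sizes n0 n)
    (Po_of_clustering R (fun k => [set i | c i == k]))
  = (2 * n%:R)^-1
    * total_cost D (fun i j => (same_cluster c [set~ ord0] i j)%:R).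
Proof.
rewrite Po_objE; congr (_ * _); apply: eq_total_cost => i j.
rewrite same_cluster_sum; apply: eq_bigr => k _.
exact: Po_of_clusteringE.
Qed.

(** * Minimizers of the relaxation with outliers *)

Lemma average_Rob_cost {R : realType} {N n : nat} {T : finType} {D : 'M[R]_N}
    {c : 'I_N -> T} {o : T} :
  (0 < #|[set~ o]|)%N ->
  Rob_obj #|[set~ o]| n D (average_point c [set~ o], average_point c [set o])
  = (2 * n%:R)^-1 * total_cost D (fun i j => (same_cluster c [set~ o] i j)%:R).
Proof.
move=> K0; have qN0 : #|[set~ o]|%:R != 0 :> R by rewrite pnatr_eq0 -lt0n.
rewrite Rob_objE; congr (_ * _); apply: eq_total_cost => i j.
by rewrite pair_prob_average mulrA divff // mul1r same_clusterC.
Qed.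

Lemma Rob_cost_ge {R : realType} {r : relaxation} {N n0 n : nat}
    {T : finType} {D : 'M[R]_N} {c : 'I_N -> T} {L : {set T}} {beta : R}
    {z : rel_var R N * rel_var R N} :
  (0 < n)%N -> (0 < #|L|)%N -> clusters_of_size c L n ->
  well_separated D (same_cluster c L) beta -> Rob_feasible r #|L| n0 n z ->
  (2 * n%:R)^-1 * total_cost D (fun i j => (same_cluster c L i j)%:R)
    <= Rob_obj #|L| n D z /\
  (Rob_obj #|L| n D z <=
     (2 * n%:R)^-1 * total_cost D (fun i j => (same_cluster c L i j)%:R) ->
   forall i j, i != j ->
     #|L|%:R * pair_prob z.1 j i = (same_cluster c L i j)%:R).
Proof.
move=> n_gt0 L0 cn sepD /(Rob_coassignment L0).
move=> /(coassignment_cost_ge cn sepD)[ge eq].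
have n2 : 0 < (2 * n%:R)^-1 :> R by rewrite invr_gt0 mulr_gt0 ?ltr0n.
by rewrite Rob_objE; split; rewrite ler_pM2l.
Qed.

Lemma average_Rob_minimizer {R : realType} {r : relaxation} {N n0 n : nat}
    {T : finType} {D : 'M[R]_N} {c : 'I_N -> T} {o : T} {beta : R} :
  (0 < n)%N -> (0 < #|[set~ o]|)%N ->
  clusters_of_size c [set~ o] n -> clusters_of_size c [set o] n0 ->
  well_separated D (same_cluster c [set~ o]) beta ->
  is_minimizer (Rob_feasible r #|[set~ o]| n0 n) (Rob_obj #|[set~ o]| n D)
    (average_point c [set~ o], average_point c [set o]).
Proof.
move=> n_gt0 K0 cn cn0 sepD; split; first exact: average_Rob_feasible.
by move=> z /(Rob_cost_ge n_gt0 K0 cn sepD)[+ _]; rewrite average_Rob_cost.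
Qed.

(* For [n = 1] the objective ignores the diagonal of [M], and the optimal [x^0]
   is not unique. *)
Lemma Rob_minimizer_x {R : realType} {r : relaxation} {N n0 n : nat}
    {T : finType} {D : 'M[R]_N} {c : 'I_N -> T} {o : T} {beta : R}
    {z : rel_var R N * rel_var R N} :
  (1 < n)%N -> (0 < #|[set~ o]|)%N ->
  clusters_of_size c [set~ o] n -> clusters_of_size c [set o] n0 ->
  well_separated D (same_cluster c [set~ o]) beta ->
  is_minimizer (Rob_feasible r #|[set~ o]| n0 n) (Rob_obj #|[set~ o]| n D) z ->
  forall i, z.2.1 i 0 = 2 * (c i == o)%:R - 1.
Proof.
move=> n1 K0 cn cn0 sepD zmin; have [zf _] := zmin.
have n_gt0 := ltnW n1.
have [_ eqV] := Rob_cost_ge n_gt0 K0 cn sepD zf.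
have := is_minimizer_le zmin (average_Rob_feasible K0 cn cn0).
rewrite average_Rob_cost // => /eqV{}eqV.
have y1 := Rob_prob zf; have [C1 _ _] := zf; have [sy _ _ _ bW] := C_relP C1.
have inE' i : (c i \in [set~ o])%:R = 1 - (c i == o)%:R :> R.
  by rewrite !inE; case: (c i == o); rewrite ?subr0 ?subrr.
(* Both sides sum to K n, so it will suffice to bound the inlier indicator by K y. *)
suff yE : (fun i => (c i \in [set~ o])%:R) =1
    (fun i => #|[set~ o]|%:R * prob z.1 i).
  by move=> i; rewrite prob_x; have := y1 i; rewrite -yE inE' => e; lra.
apply: eq_sum_le => [i|]; last first.
  by rewrite -mulr_sumr sy (sum_in_clusters cn).
have K0R : 0 <= #|[set~ o]|%:R :> R by [].
have [W0 W1 _] := bW i i.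
case: (boolP (c i \in _)) => ci; last by rewrite mulr_ge0 // (le_trans W0).
(* As n > 1, an inlier i has a companion j in its cluster, and 1 = K W_ij <= K y_i. *)
have [j ji cj] : exists2 j, j != i & c j = c i.
  have : (1 < #|[set j | c j == c i]|)%N by rewrite cn.
  rewrite (cardsD1 i) inE eqxx ltnS => /card_gt0P[j].
  by rewrite !inE => /andP[ji /eqP cj]; exists j.
have [_ Wi _] := bW i j; have := eqV _ _ ji.
rewrite /same_cluster cj eqxx ci /= => <-.
exact: ler_wpM2l.
Qed.

(** * Optimal values, squared distances and the conclusion *)

Lemma optimal_value_min {R : realType} {T : Type} {feas : set T} {obj : T -> R}
    {z : T} :
  is_minimizer feas obj z -> optimal_value feas obj = (obj z)%:E.
Proof.
move=> [zf zmin]; apply/eqP; rewrite eq_le; apply/andP; split.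
  by apply: ereal_inf_lbound; exists z.
by apply: le_ereal_inf_tmp => _ [z' z'f <-]; rewrite lee_fin zmin.
Qed.

Lemma sq_dist_mx_diag {R : realType} {N d : nat} (xi : 'I_N -> 'rV[R]_d) i :
  sq_dist_mx xi i i = 0.
Proof.
rewrite mxE /euclidean_norm subrr big1 ?sqrtr0 ?expr0n // => k _.
by rewrite mxE expr0n.
Qed.

Lemma sq_dist_mxC {R : realType} {N d : nat} (xi : 'I_N -> 'rV[R]_d) i j :
  sq_dist_mx xi i j = sq_dist_mx xi j i.
Proof.
rewrite !mxE /euclidean_norm; congr (Num.sqrt _ ^+ 2); apply: eq_bigr => k _.
by rewrite !mxE -sqrrN opprB.
Qed.

Lemma sq_dist_mx_ge0 {R : realType} {N d : nat} (xi : 'I_N -> 'rV[R]_d) i j :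
  0 <= sq_dist_mx xi i j.
Proof. by rewrite mxE sqr_ge0. Qed.

(** Recovery takes two forms because for n = 1 every clustering of the prescribed sizes has cost 0,
    so an optimal x^0 need not single out the outliers. *)
Theorem theorem5 (R : realType) (d N K n0 n : nat) (xi : 'I_N -> 'rV[R]_d)
    (J : 'I_K.+1 -> {set 'I_N})
    (hK : (1 <= K)%N) (hn : (1 <= n)%N) (hN : N = (n0 + K * n)%N)
    (hJ : is_clustering J)
    (hJn : forall k : 'I_K.+1, k != ord0 -> #|J k| = n)
    (hbetween : (max_within (sq_dist_mx xi) J
                   < min_between (sq_dist_mx xi) J)%E)
    (houtlier : (max_within (sq_dist_mx xi) J
                   < min_outlier (sq_dist_mx xi) J)%E) :
  [/\ optimal_value (@Rob_feasible R LP N K n0 n)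
        (Rob_obj K n (sq_dist_mx xi))
      = optimal_value (@Po_feasible R N K (cluster_sizes n0 n))
          (Po_obj (sq_dist_mx xi) (cluster_sizes n0 n)),
      is_minimizer (@Po_feasible R N K (cluster_sizes n0 n))
        (Po_obj (sq_dist_mx xi) (cluster_sizes n0 n))
        (Po_of_clustering R J),
      (forall r : nat -> relaxation,
        exists I : 'I_K.+1 -> {set 'I_N},
          joint_rounding (sq_dist_mx xi) r n0 n I /\
          equal_up_to_relabeling I J) &
      (n0 = 0%N \/ (1 < n)%N ->
        forall (r : nat -> relaxation) (I : 'I_K.+1 -> {set 'I_N}),
          joint_rounding (sq_dist_mx xi) r n0 n I ->
          equal_up_to_relabeling I J)].
Proof.
have [c J_def] := clustering_label hJ; move: hJ => _; subst J.
set D := sq_dist_mx xi in hbetween houtlier *.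
set L : {set 'I_K.+1} := [set~ ord0].
have cK : #|L| = K := card_setC1_ord0 K.
have L0 : (0 < #|L|)%N by rewrite cK.
have cn : clusters_of_size c L n by move=> k; rewrite !inE; exact: hJn.
have inliers : finset.setC [set i | c i == ord0] = [set i | c i \in L].
  by apply/setP => i; rewrite !inE.
have c0 : #|[set i | c i == ord0]| = n0.
  have := cardsC [set i | c i == ord0].
  rewrite inliers (card_labelled cn) cK card_ord [RHS]hN.
  exact: addIn.
have cn0 : clusters_of_size c [set ord0] n0 by move=> k; rewrite inE => /eqP->.
(* Since K >= 1, the last label is not the outlier label, and its cluster has n > 0 points. *)
have [i0 ci0] : exists i, c i != ord0.
  have : (0 < #|[set i | c i == ord_max]|)%N.
    by rewrite hJn // -(inj_eq val_inj) /= -lt0n.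
  case/card_gt0P => i; rewrite inE => /eqP ci; exists i.
  by rewrite ci -(inj_eq val_inj) /= -lt0n.
have [beta sepD] := well_separated_clustering (sq_dist_mx_diag xi)
  (sq_dist_mxC xi) ci0 hbetween houtlier.
have Rob_min r := average_Rob_minimizer (r := r) hn L0 cn cn0 sepD.
have Po_min : is_minimizer (@Po_feasible R N K (cluster_sizes n0 n))
    (Po_obj D (cluster_sizes n0 n))
    (Po_of_clustering R (fun k => [set i | c i == k])).
  split; first exact: Po_of_clustering_feasible.
  move=> z zf; rewrite Po_of_clustering_cost.
  exact: Po_cost_ge (sq_dist_mx_ge0 xi) cn sepD zf.
rewrite -/L cK in Rob_min.
have relabels r (I : 'I_K.+1 -> {set 'I_N}) : I ord0 = [set i | c i == ord0] ->
    balanced_rounding D r n ([set: 'I_N]%SET :\: I ord0) I ->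
    equal_up_to_relabeling I (fun k => [set i | c i == k]).
  move=> I0; rewrite I0 finset.setTD inliers.
  exact: balanced_rounding_relabels sepD I0.
have prefix (x : 'cV[R]_N) rho :
    (forall i, x i 0 = 2 * (c i == ord0)%:R - 1) -> sorts_decreasingly x rho ->
    [set rho a | a : 'I_N & (a < n0)%N]%SET = [set i | c i == ord0].
  move=> xE srt; rewrite -c0; apply: sorted_prefix srt _ => i j.
  by rewrite !inE !xE => -> /negbTE-> /=; lra.
split=> //.
- rewrite (optimal_value_min (Rob_min LP)) (optimal_value_min Po_min).
  rewrite Po_of_clustering_cost; congr (_%:E).
  by have := average_Rob_cost (n := n) (D := D) (c := c) L0; rewrite -/L cK.
- move=> r; pose z : rel_var R N * rel_var R N :=
    (average_point c L, average_point c [set ord0]).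
  have [rho srt] := sorts_decreasingly_ex z.2.1.
  have [I [I0 IS]] := balanced_rounding_ex (r := r)
    [set i | c i == ord0] hK hn cn sepD.
  have IS' : balanced_rounding D r n ([set: 'I_N]%SET :\: I ord0) I.
    by rewrite I0 finset.setTD inliers.
  exists I; split; last exact: relabels I0 IS'.
  exists z, rho; split=> //; rewrite I0 (prefix z.2.1) // => i.
  by rewrite mxE cards1 invr1 mul1r inE.
move=> n01 r I [z [rho [zmin srt I0 IS]]]; apply: (relabels r) IS.
(* Without outliers the prefix is empty whatever x^0 is; otherwise n > 1 determines x^0. *)
rewrite I0; have [n00|n1] := n01.
  rewrite n00 in c0 *; rewrite (cards0_eq c0).
  by apply/setP => i; rewrite inE; apply/imsetP => -[a]; rewrite inE.
apply: prefix srt; apply: Rob_minimizer_x n1 L0 cn cn0 sepD _.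
by rewrite -/L cK; exact: zmin.
Qed.
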